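(* Let $S$ be a commutative monoid, written additively with neutral element $0$, such that $x+x=x$ for all $x\in S$. Then the following property holds: (P) for all $x,y,u,v\in S$ with $x+y=u+v$ there exists $z\in S$ such that either ($x+z=u$ and $z+v=y$) or ($x=u+z$ and $v=z+y$), if and only if the partial order $\leq$ on $S$ defined by $x\leq y\iff \exists z\in S,\ x+z=y$ is total. If this holds, then the elements of the symmetrization $s(S)$ are exactly: $0$; the elements $+s:=(s,1)$ with $s\in S$ non-zero; and the elements $-s:=(s,-1)$ with $s\in S$ non-zero (these being pairwise distinct). Moreover, the addition in the hypergroup $s(S)$ is described as follows, for $x,y\in s(S)$: $$x+y=\begin{cases} x & \text{if } |x|>|y| \text{ or } x=y,\\ y & \text{if } |x|<|y| \text{ or } x=y,\\ [-x,x]=\{(t,\pm1)\mid t\in S,\ t\leq |x|\} & \text{if } y=-x,\end{cases}$$ where $|\cdot|:s(S)\to S$ denotes the map sending $\pm a\in s(S)$ to $a\in S$, and a single element on the right-hand side stands for the corresponding singleton.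
   Context: Symmetrization: for a commutative monoid $B$ written additively, $s(B)$ is the quotient of $B\times\{-1,1\}$ by the equivalence relation which identifies $(a,1)\sim(b,-1)$ whenever $a+b=0$ in $B$ (classes are written by representatives, and $\pm a:=(a,\pm1)$). Its hypersum is the commutative operation, with values in subsets of $s(B)$, given by $(a,1)+(b,1)=\{(a+b,1)\}$, $(a,-1)+(b,-1)=\{(a+b,-1)\}$, $(a,1)+(b,-1)=\{(z,1): z\in B,\ z+b=a\}\cup\{(z,-1): z\in B,\ z+a=b\}$; this is compatible with the equivalence relation. Its neutral element is the class $0=(0,1)=(0,-1)$. When $B$ has property (P) (with $B$ in place of $S$), $s(B)$ is a hypergroup, in which the opposite of $(a,1)$ is $(a,-1)$ and vice versa. *)

(* Defs.v *)
From HB Require Import structures.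
From mathcomp Require Import all_boot all_order all_algebra.
From mathcomp Require Import boolp classical_sets.

Set Implicit Arguments.
Unset Strict Implicit.
Unset Printing Implicit Defensive.

Import GRing.Theory.
Local Open Scope quotient_scope.
Local Open Scope ring_scope.
Local Open Scope classical_set_scope.

Definition property_P (S : nmodType) : Prop :=
  forall x y u v : S, x + y = u + v ->
    exists z : S, (x + z = u /\ z + v = y) \/ (x = u + z /\ v = z + y).

Definition mle (S : nmodType) (x y : S) : Prop := exists z : S, x + z = y.

Definition mlt (S : nmodType) (x y : S) : Prop := mle x y /\ x <> y.

Lemma mle_refl (S : nmodType) (x : S) : mle x x.
Proof. by exists 0; rewrite addr0. Qed.

Lemma mle_trans (S : nmodType) (y x z : S) : mle x y -> mle y z -> mle x z.
Proof. by move=> [a <-] [b <-]; exists (a + b); rewrite addrA. Qed.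

Lemma mle_anti (S : nmodType) (hS : forall x : S, x + x = x) (x y : S) :
  mle x y -> mle y x -> x = y.
Proof.
have le_addr (a b : S) : mle a b -> a + b = b by move=> [c <-]; rewrite addrA hS.
by move=> /le_addr xy /le_addr yx; rewrite -yx addrC xy.
Qed.

(* Signs are booleans: [true] stands for 1 and [false] for -1. *)
Definition symeq (B : nmodType) : rel (B * bool) :=
  fun p q => if p.2 == q.2 then p.1 == q.1 else p.1 + q.1 == 0.

Lemma symeq_refl (B : nmodType) : reflexive (@symeq B).
Proof. by move=> p; rewrite /symeq !eqxx. Qed.

Lemma symeq_sym (B : nmodType) : symmetric (@symeq B).
Proof.
by move=> p q; rewrite /symeq [q.2 == _]eq_sym [q.1 == _]eq_sym [q.1 + _]addrC.
Qed.

Lemma symeq_trans (B : nmodType) : transitive (@symeq B).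
Proof.
move=> [b f] [a e] [c g]; rewrite /symeq /=.
case: e f g => [] [] [] /= /eqP H1 /eqP H2; apply/eqP; subst=> //;
  by rewrite -[LHS]addr0 -H2 addrA H1 add0r.
Qed.

Canonical symeq_equiv (B : nmodType) :=
  EquivRel (@symeq B) (@symeq_refl B) (@symeq_sym B) (@symeq_trans B).

(* [symeq] is the smallest equivalence relation making the identifications
   (a, 1) ~ (b, -1) for a + b = 0. *)
Lemma symeq_min (B : nmodType) (r : B * bool -> B * bool -> Prop) :
  (forall p, r p p) -> (forall p q, r p q -> r q p) ->
  (forall a b : B, a + b = 0 -> r (a, true) (b, false)) ->
  forall p q, symeq p q -> r p q.
Proof.
move=> rr rs rab [a e] [b f]; rewrite /symeq /=.
case: e f => [] [] /= /eqP H; subst => //; first exact: rab.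
by apply/rs/rab; rewrite addrC.
Qed.

Definition symm (B : nmodType) : Type := {eq_quot (@symeq B)}.
HB.instance Definition _ (B : nmodType) :=
  EqQuotient.on (symm B).
HB.instance Definition _ (B : nmodType) := Choice.on (symm B).

Definition spos (B : nmodType) (a : B) : symm B := \pi_(symm B) (a, true).
Definition sneg (B : nmodType) (a : B) : symm B := \pi_(symm B) (a, false).
Definition szero (B : nmodType) : symm B := spos 0.
Arguments szero {B}.

Lemma szeroE (B : nmodType) : szero = sneg (0 : B).
Proof. by apply/eqmodP; rewrite /= /symeq /= addr0. Qed.

Definition sopp (B : nmodType) (x : symm B) : symm B :=
  let p := repr x in \pi_(symm B) (p.1, ~~ p.2).

Lemma sopp_pos (B : nmodType) (a : B) : sopp (spos a) = sneg a.
Proof.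
rewrite /sopp /spos /sneg; case: piP => -[b e] /eqmodP /=; rewrite /symeq /=.
by case: e => /= /eqP H; apply/eqmodP; rewrite /= /symeq /= ?H // addrC H.
Qed.

Lemma sopp_neg (B : nmodType) (a : B) : sopp (sneg a) = spos a.
Proof.
rewrite /sopp /spos /sneg; case: piP => -[b e] /eqmodP /=; rewrite /symeq /=.
by case: e => /= /eqP H; apply/eqmodP; rewrite /= /symeq /= ?H // addrC H.
Qed.

Definition hyperdiff (B : nmodType) (a b : B) : set (symm B) :=
  [set spos z | z in [set z : B | z + b = a]] `|`
  [set sneg z | z in [set z : B | z + a = b]].

Definition hyperadd_rep (B : nmodType) (p q : B * bool) : set (symm B) :=
  match p, q with
  | (a, true), (b, true) => [set spos (a + b)]
  | (a, false), (b, false) => [set sneg (a + b)]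
  | (a, true), (b, false) => hyperdiff a b
  | (a, false), (b, true) => hyperdiff b a
  end.

Definition hyperadd (B : nmodType) (x y : symm B) : set (symm B) :=
  hyperadd_rep (repr x) (repr y).

Lemma hyperadd_repC (B : nmodType) (p q : B * bool) :
  hyperadd_rep p q = hyperadd_rep q p.
Proof. by case: p q => [a []] [b []] //=; rewrite addrC. Qed.

Lemma pos_neg (B : nmodType) (a b : B) : a + b = 0 -> spos a = sneg b.
Proof. by move=> ab; apply/eqmodP; rewrite /= /symeq /= ab. Qed.

Lemma hyperdiff_pos (B : nmodType) (a a' b : B) : a + a' = 0 ->
  hyperdiff b a' = [set spos (a + b)].
Proof.
move=> aa'; apply/seteqP; split=> [x [] [z /= zE <-]|_ ->].
- by rewrite -zE addrCA aa' addr0.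
- by apply/esym/pos_neg; rewrite -addrA [b + z]addrC zE.
- by left; exists (a + b) => //=; rewrite addrAC aa' add0r.
Qed.

Lemma hyperdiff_neg (B : nmodType) (a a' b : B) : a + a' = 0 ->
  hyperdiff a b = [set sneg (a' + b)].
Proof.
move=> aa'; apply/seteqP; split=> [x [] [z /= zE <-]|_ ->].
- by apply/pos_neg; rewrite addrCA zE addrC.
- by rewrite -zE addrCA [a' + a]addrC aa' addr0.
- by right; exists (a' + b) => //=; rewrite addrAC [a' + a]addrC aa' add0r.
Qed.

Lemma hyperadd_rep_compat (B : nmodType) (p p' q : B * bool) :
  symeq p p' -> hyperadd_rep p q = hyperadd_rep p' q.
Proof.
case: p p' q => [a e] [a' e'] [b f]; rewrite /symeq /=.
case: e e' => [] [] /= /eqP H; rewrite ?H //.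
- by case: f; [rewrite (hyperdiff_pos _ H) | rewrite (hyperdiff_neg _ H)].
- rewrite addrC in H.
  by case: f; [rewrite (hyperdiff_pos _ H) | rewrite (hyperdiff_neg _ H)].
Qed.

Lemma hyperaddE (B : nmodType) (p q : B * bool) :
  hyperadd (\pi_(symm B) p) (\pi_(symm B) q) = hyperadd_rep p q.
Proof.
rewrite /hyperadd; case: piP => p' /eqmodP /= pp'; case: piP => q' /eqmodP /= qq'.
rewrite -(hyperadd_rep_compat _ pp') hyperadd_repC.
by rewrite -(hyperadd_rep_compat _ qq') hyperadd_repC.
Qed.

Lemma hyperadd_eq0 (B : nmodType) (x y : symm B) :
  hyperadd x y szero <-> y = sopp x.
Proof.
have pos0 (a b : B) : spos (a + b) = szero <-> spos a = sneg b.
  split=> [/eqmodP|/eqmodP]; rewrite /= /symeq /= ?addr0 => /eqP H.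
    exact: pos_neg.
  by rewrite H.
have neg0 (a b : B) : sneg (a + b) = szero <-> spos a = sneg b.
  split=> [/eqmodP|/eqmodP]; rewrite /= /symeq /= ?addr0 => /eqP H.
    exact: pos_neg.
  by rewrite H szeroE.
have posI (a b : B) : spos a = spos b -> a = b.
  by move=> /eqmodP; rewrite /= /symeq /= => /eqP.
have negI (a b : B) : sneg a = sneg b -> a = b.
  by move=> /eqmodP; rewrite /= /symeq /= => /eqP.
have diff0 (a b : B) : hyperdiff a b szero <-> a = b.
  split=> [[] [z /= zE]|->].
  - by move=> /posI z0; rewrite -zE z0 add0r.
  - by rewrite szeroE => /negI z0; rewrite -zE z0 add0r.
  - by left; exists 0; rewrite //= add0r.
elim/quotW: x => -[a e]; elim/quotW: y => -[b f]; rewrite hyperaddE.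
case: e; case: f => /=; rewrite -/(spos _) -/(sneg _) ?sopp_pos ?sopp_neg.
- split=> [/esym|H]; first by rewrite addrC pos0.
  by apply/esym; rewrite addrC pos0.
- by rewrite diff0; split=> [->//|/negI ->].
- by rewrite diff0; split=> [->//|/posI ->].
- split=> [/esym|H]; first by rewrite neg0.
  by apply/esym; rewrite neg0.
Qed.

(* In an idempotent monoid, a + b = 0 forces a = b = 0, so that this does not
   depend on the representative. *)
Definition sabs (B : nmodType) (x : symm B) : B := (repr x).1.

Lemma sabs_pi (S : nmodType) (hS : forall x : S, x + x = x) (p : S * bool) :
  sabs (\pi_(symm S) p) = p.1.
Proof.
rewrite /sabs; case: piP => q /eqmodP /=; rewrite /symeq.
case: ifP => _ /eqP // H.
have E (a b : S) : a + b = 0 -> a = 0 by move=> ab; rewrite -[a]addr0 -ab addrA hS.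
by rewrite (E _ _ H) (E q.1 p.1) // addrC.
Qed.

(* The set [-x, x] *)
Definition sinterval (S : nmodType) (x : symm S) : set (symm S) :=
  [set w | exists2 t : S, mle t (sabs x) & w = spos t \/ w = sneg t].

(* Main.v *)
(* Taking u = y and v = x in (P) shows that x and y are comparable. Conversely,
   a totally ordered idempotent monoid has x + y = max(x, y), so (P) and the
   description of the hypersum become comparisons of maxima. *)
Require Import Defs.
From mathcomp Require Import all_boot all_order all_algebra.
From mathcomp Require Import boolp classical_sets.

Import GRing.Theory.
Local Open Scope ring_scope.
Local Open Scope classical_set_scope.

Lemma mleE (S : nmodType) (hS : forall x : S, x + x = x) (x y : S) :
  mle x y <-> x + y = y.
Proof. by split=> [[z <-]|xy]; [rewrite addrA hS | exists y]. Qed.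

Lemma mle_total_property_P (S : nmodType) (hS : forall x : S, x + x = x) :
  (forall x y : S, mle x y \/ mle y x) -> property_P S.
Proof.
move=> tot.
have sel (a b : S) : a + b = a \/ a + b = b.
  by case: (tot a b) => /(mleE _ hS); [right | rewrite addrC; left].
(* Each side of the equation equals one of its summands. If these are [x] and [v], or [y] and [u],
   their common value serves as [z]; otherwise [z] is the larger of the two remaining summands. *)
move=> x y u v; case: (sel x y) => xy; case: (sel u v) => uv;
  rewrite xy uv => E; subst.
- case: (sel y v) => yv; first by exists y; left.
  by exists v; right; rewrite uv [v + y]addrC.
- by exists v; right.
- by exists u; left.
- case: (sel x u) => xu; last by exists u; left.
  by exists x; right; rewrite [u + x]addrC.
Qed.

Lemma property_P_mle_total (S : nmodType) :
  property_P S -> forall x y : S, mle x y \/ mle y x.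
Proof.
move=> P x y; have [z [[xz _]|[yz _]]] := P x y y x (addrC x y).
- by left; exists z.
- by right; exists z.
Qed.

(** Quotient induction phrased with [spos] and [sneg], so that the computation rules for signed
    classes apply directly. *)
Lemma symm_ind (B : nmodType) (Q : symm B -> Prop) :
  (forall a, Q (spos a)) -> (forall a, Q (sneg a)) -> forall x, Q x.
Proof. by move=> Qp Qn; elim/quotW => -[a []]; [exact: Qp | exact: Qn]. Qed.

Lemma spos_inj (B : nmodType) : injective (@spos B).
Proof. by move=> a b /eqmodP; rewrite /= /symeq /= => /eqP. Qed.

Lemma sneg_inj (B : nmodType) : injective (@sneg B).
Proof. by move=> a b /eqmodP; rewrite /= /symeq /= => /eqP. Qed.

Lemma sabs_spos (S : nmodType) (hS : forall x : S, x + x = x) (a : S) :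
  sabs (spos a) = a.
Proof. exact: sabs_pi. Qed.

Lemma sabs_sneg (S : nmodType) (hS : forall x : S, x + x = x) (a : S) :
  sabs (sneg a) = a.
Proof. exact: sabs_pi. Qed.

(** As [sabs] ignores the sign, [a = b]; the identification then reads [b + b = 0], and idempotency
    leaves [b = 0]. This separates the nonzero positive elements from the negative ones. *)
Lemma spos_sneg (S : nmodType) (hS : forall x : S, x + x = x) (a b : S) :
  spos a = sneg b -> a = 0 /\ b = 0.
Proof.
move=> E; have ab : a = b by rewrite -(sabs_spos _ hS a) E sabs_sneg.
by move: E => /eqmodP; rewrite /= /symeq /= ab hS => /eqP ->.
Qed.

(** Both signed parts range over the solutions of [z + a = a], which by idempotency are the [z]
    below [a]. *)
Lemma hyperdiff_self (S : nmodType) (hS : forall x : S, x + x = x) (a : S) :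
  hyperdiff a a = [set w | exists2 t : S, mle t a & w = spos t \/ w = sneg t].
Proof.
apply/seteqP; split=> [w [] [z /= za <-]|w [t /(mleE _ hS) ta [] ->]].
- by exists z; [apply/(mleE _ hS) | left].
- by exists z; [apply/(mleE _ hS) | right].
- by left; exists t.
- by right; exists t.
Qed.

(* [z] and [b] being comparable, [z + b] is their maximum, so that [z + b = a]
   with [b < a] forces [z = a]. *)
Lemma add_eq_mlt (S : nmodType) (hS : forall x : S, x + x = x)
    (tot : forall x y : S, mle x y \/ mle y x) (a b z : S) :
  mlt b a -> z + b = a <-> z = a.
Proof.
move=> [ba nba]; split=> [zb|->]; last by rewrite addrC; apply/(mleE _ hS).
have [/(mleE _ hS) zb'|/(mleE _ hS)] := tot z b; last by rewrite addrC zb.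
by case: nba; rewrite -zb.
Qed.

(** A sum dominates its summands, so equality would put [a] below [b], against antisymmetry. *)
Lemma add_neq_mlt (S : nmodType) (hS : forall x : S, x + x = x) (a b z : S) :
  mlt b a -> z + a <> b.
Proof.
by move=> [ba nba] zab; apply: nba; apply: (mle_anti hS ba); exists z; rewrite addrC.
Qed.

(** The positive part has [a] as its only solution, and the negative part is empty. *)
Lemma hyperdiff_gt (S : nmodType) (hS : forall x : S, x + x = x)
    (tot : forall x y : S, mle x y \/ mle y x) (a b : S) :
  mlt b a -> hyperdiff a b = [set spos a].
Proof.
move=> ba; apply/seteqP; split=> [w [] [z /= E <-]|_ ->].
- by move/(add_eq_mlt _ hS tot _ _ _ ba): E => ->.
- by case: (add_neq_mlt _ hS _ _ _ ba E).
- by left; exists a => //=; apply/add_eq_mlt.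
Qed.

Lemma hyperdiff_lt (S : nmodType) (hS : forall x : S, x + x = x)
    (tot : forall x y : S, mle x y \/ mle y x) (a b : S) :
  mlt a b -> hyperdiff a b = [set sneg b].
Proof.
move=> ab; apply/seteqP; split=> [w [] [z /= E <-]|_ ->].
- by case: (add_neq_mlt _ hS _ _ _ ab E).
- by move/(add_eq_mlt _ hS tot _ _ _ ab): E => ->.
- by right; exists b => //=; apply/add_eq_mlt.
Qed.

Lemma hyperaddC (B : nmodType) (x y : symm B) : hyperadd x y = hyperadd y x.
Proof. exact: hyperadd_repC. Qed.

Lemma hyperaddxx (S : nmodType) (hS : forall x : S, x + x = x) (x : symm S) :
  hyperadd x x = [set x].
Proof. by elim/symm_ind: x => a; rewrite hyperaddE /= hS. Qed.

Lemma hyperadd_mlt (S : nmodType) (hS : forall x : S, x + x = x)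
    (tot : forall x y : S, mle x y \/ mle y x) (x y : symm S) :
  mlt (sabs y) (sabs x) -> hyperadd x y = [set x].
Proof.
elim/symm_ind: x => a; elim/symm_ind: y => b;
  rewrite hyperaddE ?(sabs_spos _ hS) ?(sabs_sneg _ hS) /= => ba.
- by rewrite addrC (iffLR (mleE _ hS _ _) ba.1).
- exact: hyperdiff_gt.
(* For a negative [x] and a positive [y] the hypersum is [hyperdiff b a], with the arguments
   exchanged. *)
- exact: hyperdiff_lt.
- by rewrite addrC (iffLR (mleE _ hS _ _) ba.1).
Qed.

Lemma hyperadd_sopp (S : nmodType) (hS : forall x : S, x + x = x) (x : symm S) :
  hyperadd x (sopp x) = sinterval x.
Proof.
by elim/symm_ind: x => a; rewrite ?sopp_pos ?sopp_neg hyperaddE /sinterval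
  ?(sabs_spos _ hS) ?(sabs_sneg _ hS) /= hyperdiff_self.
Qed.

Lemma sabs_eq (S : nmodType) (hS : forall x : S, x + x = x) (x y : symm S) :
  sabs x = sabs y -> x = y \/ y = sopp x.
Proof.
elim/symm_ind: x => a; elim/symm_ind: y => b;
  rewrite ?sopp_pos ?sopp_neg ?(sabs_spos _ hS) ?(sabs_sneg _ hS) => ->;
  by [left | right].
Qed.

Theorem proposition6p2 (S : nmodType) (hS : forall x : S, x + x = x) :
  (property_P S <-> (forall x y : S, mle x y \/ mle y x)) /\
  (property_P S ->
    [/\ (* elements of s(S) *)
        forall x : symm S, [\/ x = szero,
                               exists2 s : S, s <> 0 & x = spos s |
                               exists2 s : S, s <> 0 & x = sneg s],
        (* these are pairwise distinct *)
        [/\ forall s : S, s <> 0 -> spos s <> szero /\ sneg s <> szero,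
            forall s t : S, s <> 0 -> t <> 0 -> spos s <> sneg t,
            forall s t : S, s <> 0 -> t <> 0 -> spos s = spos t -> s = t &
            forall s t : S, s <> 0 -> t <> 0 -> sneg s = sneg t -> s = t],
        (* |+a| = |-a| = a *)
        forall a : S, sabs (spos a) = a /\ sabs (sneg a) = a &
        (* the hypersum; the listed cases cover all pairs *)
        forall x y : symm S,
          [/\ [\/ mlt (sabs y) (sabs x), mlt (sabs x) (sabs y), x = y |
                  y = sopp x],
              mlt (sabs y) (sabs x) \/ x = y -> hyperadd x y = [set x],
              mlt (sabs x) (sabs y) \/ x = y -> hyperadd x y = [set y] &
              y = sopp x -> hyperadd x y = sinterval x]]).
Proof.
split; first by split; [exact: property_P_mle_total | exact: mle_total_property_P].
move/property_P_mle_total => tot; split.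
- elim/symm_ind => a; have [->|/eqP a0] := eqVneq a 0;
    by [exact: Or31 | rewrite -szeroE; exact: Or31
       | apply: Or32; exists a | apply: Or33; exists a].
- split=> [s s0|s t s0 _|s t _ _|s t _ _].
  + by split=> [/spos_inj|]; [|rewrite szeroE => /sneg_inj].
  + by move=> /(spos_sneg _ hS) [].
  + exact: spos_inj.
  + exact: sneg_inj.
- by move=> a; rewrite sabs_spos ?sabs_sneg.
- move=> x y; split.
  (* Equal absolute values leave only [x = y] or opposite elements; for distinct ones, totality
     gives a strict comparison. *)
  + have [E|nE] := pselect (sabs x = sabs y).
      by case: (sabs_eq _ hS _ _ E); [exact: Or43 | exact: Or44].
    by case: (tot (sabs x) (sabs y)) => le; [apply: Or42 | apply: Or41];
      split=> // /esym.
  + by case=> [|<-]; [exact: hyperadd_mlt | exact: hyperaddxx].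
  + by rewrite hyperaddC; case=> [|<-]; [exact: hyperadd_mlt | exact: hyperaddxx].
  + by move=> ->; exact: hyperadd_sopp.
Qed.
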